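(* Let $\lambda,\mu$ be partitions with $D(\mu)\subset D(\lambda)$, let $N$ be a positive integer, let $\boldsymbol s=(s_{ij})\in T^{\mathrm{diag}}(\lambda/\mu,\mathbb C)$, i.e. $s_{ij}=a_{j-i}$ for a family $(a_c)_{c\in\mathbb Z}$ of complex numbers, and let $(\theta_1,\ldots,\theta_n)$ be any outside decomposition of $\lambda/\mu$. Then \[ S^{\mathrm{sp},N}_{\lambda/\mu}(\boldsymbol s)=\det\left(S^{\mathrm{sp},N}_{\theta_i\#\theta_j}(\boldsymbol s_{\theta_i}\#\boldsymbol s_{\theta_j})\right)_{1\le i,j\le n}, \] where $\boldsymbol s_{\theta_i}\#\boldsymbol s_{\theta_j}$ is the filling of $\theta_i\#\theta_j$ having $a_c$ in its box of content $c$, and the $(i,j)$ entry is $1$ if $\theta_i\#\theta_j=\emptyset$ and $0$ if $\theta_i\#\theta_j$ is undefined.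
   Context: Diagrams. For a partition $\lambda=(\lambda_1,\ldots,\lambda_r)$, $D(\lambda)=\{(i,j): 1\le i\le r,\ 1\le j\le\lambda_i\}$ (row $i$ downwards, column $j$ to the right), and $D(\lambda/\mu)=D(\lambda)\setminus D(\mu)$. The content of box $(i,j)$ is $j-i$. $T^{\mathrm{diag}}(\lambda/\mu,\mathbb C)$ is the set of complex fillings of $D(\lambda/\mu)$ that are constant on diagonals of fixed content. Symplectic quasi-symmetric functions. Let $[\overline N]=\{1<\overline1<2<\overline2<\cdots<N<\overline N\}$, with $|i|=i$ and $|\overline i|=i^{-1}$. Let $E$ be a skew diagram, or a strip whose boxes carry prescribed contents. A symplectic tableau of shape $E$ is a filling of $E$ with letters of $[\overline N]$, weakly increasing along each row (left to right), strictly increasing down each column, such that each box of content $-i$ has entry $\ge i+1$ (vacuous for $-i\ge 0$). For a complex filling $\boldsymbol s$ of $E$, the symplectic quasi-symmetric function is $S_E^{\mathrm{sp},N}(\boldsymbol s)=\sum_M\prod_{\alpha\in E}|m_\alpha|^{s_\alpha}$, summed over all symplectic tableaux $M=(m_\alpha)$ of shape $E$; $S^{\mathrm{sp},N}_{\lambda/\mu}$ is the case $E=D(\lambda/\mu)$. Outside decompositions. A strip is an edgewise connected skew diagram containing no $2\times2$ block; its starting box is its bottommost-leftmost box and its ending box is its topmost-rightmost box. A box $(i,j)$ of a diagram is on its left (resp. right, top, bottom) perimeter if $(i,j-1)$ (resp. $(i,j+1)$, $(i-1,j)$, $(i+1,j)$) is not in the diagram. An outside decomposition of $\lambda/\mu$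 is an ordered set $(\theta_1,\ldots,\theta_n)$ of strips whose disjoint union is $D(\lambda/\mu)$, each having its starting box on the left or bottom perimeter of $D(\lambda/\mu)$ and its ending box on the right or top perimeter. Operation $\#$. A non-starting box of a strip is approached from the left (resp. from below) if the preceding box of the strip is immediately to its left (resp. below it). It is known that, for each content $c$, a direction $d(c)\in\{\text{left},\text{below}\}$ can be chosen so that every non-starting box of content $c$ in the strips is approached from direction $d(c)$, and every starting box of content $c$ is on the left perimeter if $d(c)=\text{left}$ and on the bottom perimeter if $d(c)=\text{below}$; if no box of $D(\lambda/\mu)$ has content $c$ then $d(c)$ is chosen arbitrarily. Fix such choices. For $p\le q$ let $R[p,q]$ be the strip with exactly one box of each content $p,p+1,\ldots,q$, where the box of content $c$ ($p<c\le q$) is immediately to the right of the box of content $c-1$ if $d(c)=\text{left}$ and immediately above it if $d(c)=\text{below}$. If $p_i$ and $q_i$ denote the contents of the starting and ending boxes of $\theta_i$ (so $\theta_i$ is a diagonal translate of $R[p_i,q_i]$), then $\theta_i\#\theta_j=R[p_j,q_i]$ if $p_j\le q_i$, $\theta_i\#\theta_j=\emptyset$ if $p_j=q_i+1$, and $\theta_i\#\theta_j$ is undefined if $p_j>q_i+1$. Boxes of $\theta_i\#\theta_j$ keep their contents $p_j,\ldots,q_i$. *)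

(* Defs.v *)
From mathcomp Require Import all_boot all_order all_algebra.
From mathcomp Require Import finmap complex reals sequences exp trigo.

Set Implicit Arguments.
Unset Strict Implicit.
Unset Printing Implicit Defensive.

Import Order.TTheory GRing.Theory Num.Theory.
Local Open Scope complex_scope.
Local Open Scope fset_scope.
Local Open Scope ring_scope.

(* Boxes are pairs (row, column), rows numbered downwards and columns to the
   right.  Coordinates are integers because the strips R[p,q] below are placed
   in the whole plane. *)
Definition box : Type := (int * int)%type.

Definition content (b : box) : int := b.2 - b.1.

Definition left_of (b : box) : box := (b.1, b.2 - 1).
Definition right_of (b : box) : box := (b.1, b.2 + 1).
Definition above (b : box) : box := (b.1 - 1, b.2).
Definition below (b : box) : box := (b.1 + 1, b.2).

Definition is_part (la : seq nat) : bool := sorted geq la && (0%N \notin la).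

Definition diagram (la : seq nat) : {fset box} :=
  [fset (i%:Z, j%:Z) | i in iota 1 (size la), j in iota 1 (nth 0%N la i.-1)].

Definition skew_diagram (la mu : seq nat) : {fset box} :=
  diagram la `\` diagram mu.

Definition is_skew (E : {fset box}) : Prop :=
  exists la mu : seq nat,
    [/\ is_part la, is_part mu, diagram mu `<=` diagram la
      & E = skew_diagram la mu].

(* The ordered alphabet 1 < \bar 1 < 2 < \bar 2 < ... < N < \bar N, numbered
   from 0: the letter k is 2(k-1) and the letter \bar k is 2(k-1)+1. *)
Definition letter (N : nat) : Type := 'I_(N.*2).

Definition letter_abs (R : realType) (N : nat) (m : letter N) : R :=
  if odd m then (m./2.+1)%:R^-1 else (m./2.+1)%:R.

(* x ^ s = exp (s ln x) for real x > 0 and complex s. *)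
Definition cpow (R : realType) (x : R) (s : R[i]) : R[i] :=
  (expR (complex.Re s * ln x))%:C *
  (cos (complex.Im s * ln x) +i* sin (complex.Im s * ln x)).

(* In the last clause, the letter i+1 has number 2i. *)
Definition is_sptab (N : nat) (E : {fset box}) (M : {ffun E -> letter N})
    : bool :=
  [&& [forall b : E, forall b' : E,
         ((val b).1 == (val b').1) && ((val b).2 <= (val b').2)
           ==> (M b <= M b')%N],
      [forall b : E, forall b' : E,
         ((val b).2 == (val b').2) && ((val b).1 < (val b').1)
           ==> (M b < M b')%N]
    & [forall b : E,
         (content (val b) <= 0) ==> (`|content (val b)|.*2 <= M b)%N]].

Definition spS (R : realType) (N : nat) (E : {fset box}) (s : E -> R[i])
    : R[i] :=
  \sum_(M : {ffun E -> letter N} | is_sptab M)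
    \prod_(b : E) cpow (letter_abs R (M b)) (s b).

Definition diag_filling (R : realType) (a : int -> R[i]) (E : {fset box})
    : E -> R[i] :=
  fun b => a (content (val b)).

Definition adjacent (b b' : box) : bool :=
  b' \in [:: left_of b; right_of b; above b; below b].

Definition edgewise_connected (E : {fset box}) : Prop :=
  forall b b' : E, connect (fun x y : E => adjacent (val x) (val y)) b b'.

Definition has_2x2_block (E : {fset box}) : Prop :=
  exists b : box,
    [/\ b \in E, right_of b \in E, below b \in E & right_of (below b) \in E].

Definition is_strip (E : {fset box}) : Prop :=
  [/\ E != fset0, is_skew E, edgewise_connected E & ~ has_2x2_block E].

Definition is_start (E : {fset box}) (b : box) : Prop :=
  b \in E /\ forall b' : box, b' \in E -> b'.1 <= b.1 /\ b.2 <= b'.2.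

Definition is_end (E : {fset box}) (b : box) : Prop :=
  b \in E /\ forall b' : box, b' \in E -> b.1 <= b'.1 /\ b'.2 <= b.2.

Definition on_left (E : {fset box}) (b : box) : bool :=
  (b \in E) && (left_of b \notin E).
Definition on_right (E : {fset box}) (b : box) : bool :=
  (b \in E) && (right_of b \notin E).
Definition on_top (E : {fset box}) (b : box) : bool :=
  (b \in E) && (above b \notin E).
Definition on_bottom (E : {fset box}) (b : box) : bool :=
  (b \in E) && (below b \notin E).

Definition outside_decomposition (E : {fset box}) (n : nat)
    (theta : 'I_n -> {fset box}) : Prop :=
  [/\ forall i, is_strip (theta i),
      forall i j, i != j -> [disjoint theta i & theta j]%fset,
      E = (\bigcup_(i in 'I_n) theta i)%fset,
      forall i b, is_start (theta i) b -> on_left E b || on_bottom E b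
    & forall i b, is_end (theta i) b -> on_right E b || on_top E b].

Inductive direction : Type := FromLeft | FromBelow.

(* A strip contains at most one box of each content, and both candidates below
   have content one less than b: whichever of them lies in the strip is the box
   preceding b. *)
Definition approached_from (t : direction) (E : {fset box}) (b : box) : bool :=
  match t with
  | FromLeft => left_of b \in E
  | FromBelow => below b \in E
  end.

Definition start_perimeter (t : direction) (E : {fset box}) (b : box) : bool :=
  match t with
  | FromLeft => on_left E b
  | FromBelow => on_bottom E b
  end.

Definition compatible (E : {fset box}) (n : nat) (theta : 'I_n -> {fset box})
    (d : int -> direction) : Prop :=
  (forall i b, b \in theta i -> ~ is_start (theta i) b ->
     approached_from (d (content b)) (theta i) b) /\
  (forall i b, is_start (theta i) b -> start_perimeter (d (content b)) E b).

(* The box of content p + k of the strips R[p,q], normalized so that the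
   starting box, of content p, is (0,p). *)
Fixpoint ribbon_box (d : int -> direction) (p : int) (k : nat) : box :=
  match k with
  | 0 => (0, p)
  | k'.+1 =>
      match d (p + k%:Z) with
      | FromLeft => right_of (ribbon_box d p k')
      | FromBelow => above (ribbon_box d p k')
      end
  end.

(* R[p,q], meant for p <= q. *)
Definition ribbon (d : int -> direction) (p q : int) : {fset box} :=
  [fset ribbon_box d p k | k in iota 0 `|q - p|.+1].

(* theta_i # theta_j as a function of the starting box of theta_j and of the
   ending box of theta_i; None stands for "undefined". *)
Definition sharp (d : int -> direction) (start_j end_i : box)
    : option {fset box} :=
  let p := content start_j in
  let q := content end_i in
  if p <= q then Some (ribbon d p q)
  else if p == q + 1 then Some fset0
  else None.

Definition sharp_entry (R : realType) (N : nat) (a : int -> R[i])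
    (E : option {fset box}) : R[i] :=
  match E with
  | None => 0
  | Some E => if E == fset0 then 1 else spS N (diag_filling a (E := E))
  end.

(* Main.v *)
Require Import Defs.
From mathcomp Require Import all_boot all_order all_algebra.
From mathcomp Require Import fingroup perm zify.
From mathcomp Require Import finmap complex reals sequences exp trigo.

Set Implicit Arguments.
Unset Strict Implicit.
Unset Printing Implicit Defensive.

Import Order.TTheory GRing.Theory Num.Theory.
Local Open Scope complex_scope.
Local Open Scope fset_scope.
Local Open Scope ring_scope.

(** Both sides are compared by sweeping the diagonals of the diagram in order
    of increasing content.

    A filling of a skew shape is row-weak and column-strict as soon as every
    box is right with respect to its left and its lower neighbour
    ([local_tableau]); both neighbours have content one less than the box.  The
    condition that a box of content -i carries an entry at least i+1 involves
    only the letter and the content of the box, so it is absorbed into the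
    weight of the letter ([spS_local]).  What remains is an identity for
    arbitrary weights f c y, depending on a content c and a letter y, with
    values in a commutative ring ([strip_determinant]).

    Suppose that the boxes of content at most c are filled by M.  The matrix
    [front_mx c M] has a unit row for each strip that ends before content c; for
    a strip that is under way, its i-th entry is the weighted number of ways to
    prolong this strip alone, along the directions d, from its current letter
    up to the last content of the i-th strip; a strip that has not started yet
    has the row of its complete prolongations.  Before all contents this is
    the matrix of the theorem, transposed; beyond all contents it is the
    identity.  The heart of the proof ([front_step]) is that the determinant at
    c is the sum of the determinants at c+1 over the admissible fillings of the
    diagonal c+1.

    For that, let d(c+1) be the direction left.  A strip whose box of content
    c carries x may continue by any y >= x, whereas the tableau requires
    x <= y < x', where x' is the letter below the new box, if there is one.
    This x' is the current letter of the next strip on the diagonal c, so subtracting the row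
    of that strip from the row at hand removes exactly the terms with
    y >= x'.  For the direction below, the terms y < x are kept and the row of
    the strip through the left neighbour of the new box is subtracted.  Thus
    unitriangular row operations turn the inequalities that govern single
    strips into the interlacing conditions of a tableau, and multilinearity of
    the determinant in its rows does the rest: no cancellation between
    intersecting families of paths is needed.  A strip that ends at content c
    has the entry 1 in its column for every strip under way or about to start;
    after the subtraction only the diagonal entry survives, so its row may be replaced by a unit row.

    The geometry uses only that a skew diagram is convex for the product order
    of the plane.  A strip R[p,q] is convex as well, and it is an outside
    decomposition of itself by one strip; the same identity in size 1
    ([ribbon_sum]) therefore identifies the entries of the matrix. *)

(** * Determinants under row operations *)

Section Determinants.

Variables (K : comNzRingType) (n : nat).
Implicit Types A B : 'M[K]_n.

(** A strictly increasing rank makes the row operation unipotent: a permutation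
    contributing to the determinant of its matrix never lowers the rank, and
    the sum of the ranks is preserved, so the permutation is the identity.
    Ranks replace a triangular shape because the strips are not numbered in
    their order along a diagonal. *)
Lemma det_sub_rows A B (up : 'I_n -> option 'I_n) (rk : 'I_n -> int) :
  (forall j k, up j = Some k -> rk j < rk k) ->
  (forall j i, B j i = A j i - (if up j is Some k then A k i else 0)) ->
  \det B = \det A.
Proof.
move=> up_lt BE.
pose U : 'M[K]_n := \matrix_(j, k) ((j == k)%:R - (up j == Some k)%:R).
have -> : B = U *m A.
  apply/matrixP=> j i; rewrite BE !mxE.
  transitivity (\sum_k ((k == j)%:R * A k i - (up j == Some k)%:R * A k i)).
    rewrite sumrB; congr (_ - _).
      rewrite (bigD1 j) //= eqxx mul1r big1 ?addr0 // => k /negbTE ->.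
      by rewrite mul0r.
    case: (up j) => [k|]; last by rewrite big1 // => k _; rewrite mul0r.
    rewrite (bigD1 k) //= eqxx mul1r big1 ?addr0 // => l lk.
    by rewrite (inj_eq Some_inj) eq_sym (negbTE lk) mul0r.
  by apply: eq_bigr => k _; rewrite mxE mulrBl eq_sym.
rewrite det_mulmx; suff -> : \det U = 1 by rewrite mul1r.
have Ujj j : U j j = 1.
  rewrite mxE eqxx; case: eqP => [/up_lt|_]; last by rewrite subr0.
  by rewrite ltxx.
rewrite /determinant (bigD1 (1%g : 'S_n)) //= [X in _ + X]big1 ?addr0.
  by rewrite odd_perm1 mul1r big1 // => j _; rewrite perm1.
move=> s s1; have [j /eqP sj] : exists j, s j != j.
  apply/existsP; rewrite -negb_forall; apply: contra s1 => /forallP s_id.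
  by apply/eqP/permP => j; rewrite perm1; apply/eqP.
have [/existsP[k Uk0]|] := boolP [exists k, U k (s k) == 0].
  by rewrite (bigD1 k) //= (eqP Uk0) mul0r mulr0.
rewrite negb_exists => /forallP nz.
have le_rk k : rk k <= rk (s k).
  have := nz k; rewrite mxE; case: (k =P s k) => [<- //|_].
  by case: (up k =P _) => [/up_lt/ltW //|_]; rewrite subrr eqxx.
have lt_rk : rk j < rk (s j).
  have := nz j; rewrite mxE; case: (j =P s j) => [jE|_]; first by rewrite -jE in sj.
  by case: (up j =P _) => [/up_lt //|_]; rewrite subrr eqxx.
have : \sum_k rk k < \sum_k rk (s k).
  by rewrite (bigD1 j) //= [ltRHS](bigD1 j) //= ltr_leD // ler_sum.
by rewrite [ltLHS](reindex_inj (@perm_inj _ s)) ltxx.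
Qed.

(** In a column that is zero off the diagonal a contributing permutation must
    pick the diagonal entry, so the rest of the corresponding row is never
    used. *)
Lemma det_unit_cols A B (D : pred 'I_n) :
  (forall i j, D i -> j != i -> A j i = 0) ->
  (forall i j, D i -> j != i -> B j i = 0) ->
  (forall i, D i -> A i i = B i i) ->
  (forall j i, ~~ D j -> A j i = B j i) ->
  \det A = \det B.
Proof.
move=> A0 B0 ABd AB; apply: eq_bigr => s _; congr (_ * _).
have [/forallP sD|] := boolP [forall j, D j ==> (s j == j)].
  apply: eq_bigr => j _; have [Dj|/AB //] := boolP (D j).
  by have /implyP/(_ Dj)/eqP -> := sD j; apply: ABd.
rewrite negb_forall => /existsP[j]; rewrite negb_imply => /andP[Dj sj].
pose k := (s^-1)%g j; have skj : s k = j by rewrite permKV.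
have kj : k != j by apply: contra sj => /eqP kj; rewrite -{1}kj skj.
by rewrite (bigD1 k) //= [RHS](bigD1 k) //= skj A0 ?B0 // !mul0r.
Qed.

(** Multilinearity of the determinant in the rows attached to the indices in D.
    The summation runs over functions on all of I, prescribed by M0 outside D,
    so that fillings of successive diagonals live in one type. *)
Lemma det_expand_rows (I J : finType) A (D : pred I) (row_of : I -> 'I_n)
    (Q : I -> pred J) (g : I -> J -> K) (V : J -> 'I_n -> K)
    (M0 : {ffun I -> J}) (C : {ffun I -> J} -> 'M[K]_n) :
  {in D &, injective row_of} ->
  (forall b i, D b -> A (row_of b) i = \sum_(y | Q b y) g b y * V y i) ->
  (forall M b i, D b -> C M (row_of b) i = V (M b) i) ->
  (forall M j i, (forall b, D b -> row_of b != j) -> C M j i = A j i) ->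
  \det A = \sum_(M in family (fun b => if D b then Q b else pred1 (M0 b)))
             (\prod_(b | D b) g b (M b)) * \det (C M).
Proof.
move=> row_inj AD CD CA; rewrite /determinant.
under [RHS]eq_bigr do rewrite mulr_sumr; rewrite exchange_big /=.
apply: eq_bigr => s _.
pose T := [set row_of b | b in [set b | D b]].
have splitT (X : 'M[K]_n) : \prod_j X j (s j) =
    (\prod_(b | D b) X (row_of b) (s (row_of b))) *
      \prod_(j | j \notin T) X j (s j).
  rewrite (bigID (mem T)) /=; congr (_ * _).
  rewrite big_imset /=; last by move=> b c; rewrite !inE; apply: row_inj.
  by apply: eq_bigl => b; rewrite inE.
(* Off D the factor is 1 and the inner sum has the single term M0 b, so that
   the whole product distributes over functions on I. *)
pose F b y := if D b then g b y * V y (s (row_of b)) else 1.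
have -> : \prod_j A j (s j) =
    (\prod_b \sum_(y in (if D b then Q b else pred1 (M0 b))) F b y)
      * \prod_(j | j \notin T) A j (s j).
  rewrite splitT; congr (_ * _); rewrite big_mkcond /=; apply: eq_bigr => b _.
  rewrite /F; have [Db|_] := boolP (D b); first exact: AD.
  by rewrite (big_pred1 (M0 b)).
rewrite (bigA_distr_big_dep (fun b => mem (if D b then Q b else pred1 (M0 b)))).
rewrite mulr_suml mulr_sumr; apply: eq_bigr => M _.
rewrite (splitT (C M)) [RHS]mulrCA; congr (_ * _); rewrite mulrA.
congr (_ * _).
  rewrite -big_split [RHS]big_mkcond; apply: eq_bigr => b _; rewrite /F.
  by case: ifP => // Db; rewrite CD.
apply: eq_bigr => j jT; rewrite CA // => b Db; apply: contra jT => /eqP <-.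
by apply: imset_f; rewrite inE.
Qed.

End Determinants.

(** * Tableaux through conditions between neighbours *)

Definition order_convex (E : {fset box}) : Prop :=
  forall b1 b2 b : box, b1 \in E -> b2 \in E ->
    b1.1 <= b.1 <= b2.1 -> b1.2 <= b.2 <= b2.2 -> b \in E.

Section LocalConditions.

Variables (m : nat) (E : {fset box}).
Implicit Types (M : {ffun E -> 'I_m}) (b : box) (x : option 'I_m) (y : 'I_m).

(** Boxes outside the shape are looked up as None, which imposes no
    inequality; this makes perimeter boxes uniform with the others. *)
Definition lookup M b : option 'I_m := omap M (insub b).

Lemma lookup_val M (b : E) : lookup M (val b) = Some (M b).
Proof. by rewrite /lookup valK. Qed.

Lemma lookup_notin M b : b \notin E -> lookup M b = None.
Proof. by move=> bE; rewrite /lookup insubN. Qed.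

Lemma lookup_in M b (bE : b \in E) : lookup M b = Some (M [` bE]).
Proof. by rewrite -lookup_val. Qed.

Lemma eq_lookup M M' b :
  (forall b' : E, val b' = b -> M b' = M' b') -> lookup M b = lookup M' b.
Proof. by rewrite /lookup; case: insubP => //= u _ ub ->. Qed.

Definition le_opt x y : bool := if x is Some z then (z <= y)%N else true.
Definition gt_opt x y : bool := if x is Some z then (y < z)%N else true.

Definition local M b y : bool :=
  le_opt (lookup M (left_of b)) y && gt_opt (lookup M (below b)) y.

Lemma eq_local M M' b y :
  (forall b' : E, content (val b') = content b - 1 -> M b' = M' b') ->
  local M b y = local M' b y.
Proof.
move=> MM'; rewrite /local.
by congr (le_opt _ _ && gt_opt _ _); apply: eq_lookup => b' b'b; apply: MM';
  rewrite b'b /content /=; lia.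
Qed.

(** The left and lower neighbours of b are the opposite corners of a square
    whose fourth box lies in the shape by convexity; passing through that box
    compares the two letters, which are consecutive on their diagonal. *)
Lemma local_square M b (u v : 'I_m) :
  order_convex E ->
  (forall b' : E, content (val b') = content b - 1 -> local M (val b') (M b')) ->
  lookup M (left_of b) = Some u -> lookup M (below b) = Some v -> (u <= v)%N.
Proof.
move=> convE locM; have [lE|/lookup_notin->//] := boolP (left_of b \in E).
have [bE|/lookup_notin->//] := boolP (below b \in E).
have cE : below (left_of b) \in E by apply: (convE _ _ _ lE bE) => /=; lia.
rewrite !lookup_in => -[<-] [<-].
have := locM [` lE]; have := locM [` bE]; rewrite /local /=.
have -> : left_of (below b) = below (left_of b) by [].
rewrite !(lookup_in _ cE) /content /= => /(_ _)/andP[|+ _]; first by lia.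
by move=> le_cb /(_ _)/andP[|_ /ltnW lt_lc]; [lia | apply: leq_trans le_cb].
Qed.

(** Convexity supplies all boxes between two boxes of the same row or
    column. *)
Lemma local_tableau M :
  order_convex E ->
  [forall b : E, local M (val b) (M b)] =
  [forall b : E, forall b' : E,
         ((val b).1 == (val b').1) && ((val b).2 <= (val b').2)
           ==> (M b <= M b')%N] &&
  [forall b : E, forall b' : E,
         ((val b).2 == (val b').2) && ((val b).1 < (val b').1)
           ==> (M b < M b')%N].
Proof.
move=> convE; apply/forallP/andP => [locM|[/forallP rowM /forallP colM] b].
  have row k : forall b b' : E, (val b).1 = (val b').1 ->
      (val b).2 + k%:Z = (val b').2 -> (M b <= M b')%N.
    elim: k => [|k IHk] b b' /= eq1 eq2.
      suff -> : b = b' by [].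
      apply: val_inj => /=; move: eq1 eq2; case: (fsval b) (fsval b') => [i j] [i' j'] /=.
      by move=> -> <-; rewrite addr0.
    have lE : left_of (val b') \in E.
      by apply: (convE _ _ _ (fsvalP b) (fsvalP b')) => /=; lia.
    have /andP[+ _] := locM b'; rewrite (lookup_in _ lE) /=.
    by apply: leq_trans; apply: IHk => /=; lia.
  have col k : forall b b' : E, (val b).2 = (val b').2 ->
      (val b).1 + k.+1%:Z = (val b').1 -> (M b < M b')%N.
    elim: k => [|k IHk] b b' /= eq2 eq1.
      have bE : below (val b) \in E.
        by apply: (convE _ _ _ (fsvalP b) (fsvalP b')) => /=; lia.
      have /andP[_] := locM b; rewrite (lookup_in _ bE) /=.
      suff -> : [` bE] = b' by [].
      apply: val_inj; move: eq1 eq2; rewrite /= /below.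
      by case: (fsval b) (fsval b') => [i j] [i' j'] /= <- <-.
    have bE : below (val b) \in E.
      by apply: (convE _ _ _ (fsvalP b) (fsvalP b')) => /=; lia.
    have /andP[_] := locM b; rewrite (lookup_in _ bE) /= => /ltn_trans; apply.
    by apply: IHk => /=; lia.
  split; apply/forallP => b; apply/forallP => b'; apply/implyP => /= /andP[/eqP].
    by move=> eq1 le2; apply: (row `|(fsval b').2 - (fsval b).2|%N) => //=; lia.
  move=> eq2 lt1.
  by apply: (col `|(fsval b').1 - (fsval b).1|.-1%N) => //=; lia.
apply/andP; split.
  have [lE|/lookup_notin -> //] := boolP (left_of (val b) \in E).
  rewrite lookup_in /=; have /forallP/(_ b)/implyP := rowM [` lE]; apply.
  by rewrite /=; lia.
have [bE|/lookup_notin -> //] := boolP (below (val b) \in E).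
rewrite lookup_in /=; have /forallP/(_ [` bE])/implyP := colM b; apply.
by rewrite /=; lia.
Qed.

Lemma sum_predB (K : comNzRingType) (F : 'I_m -> K) (P Q S : pred 'I_m) :
  (forall y, P y = Q y || S y) -> (forall y, ~~ (Q y && S y)) ->
  \sum_(y | Q y) F y = \sum_(y | P y) F y - \sum_(y | S y) F y.
Proof.
move=> PE QS; rewrite !(big_mkcond Q) (big_mkcond P) (big_mkcond S) -sumrB.
apply: eq_bigr => y _; rewrite PE; have := QS y.
by case: (Q y); case: (S y); rewrite ?subr0 ?subrr.
Qed.

(** The two inequalities imposed on a new box, obtained by subtracting sums
    that each involve a single inequality: the first form serves the direction
    left, the second the direction below. *)
Lemma sum_interlace (K : comNzRingType) (F : 'I_m -> K) (u v : option 'I_m) :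
  (forall y z, u = Some y -> v = Some z -> (y <= z)%N) ->
  \sum_(y | le_opt u y && gt_opt v y) F y
    = \sum_(y | le_opt u y) F y
      - (if v is Some _ then \sum_(y | le_opt v y) F y else 0)
  /\ \sum_(y | le_opt u y && gt_opt v y) F y
    = \sum_(y | gt_opt v y) F y
      - (if u is Some _ then \sum_(y | gt_opt u y) F y else 0).
Proof.
move=> uv; split.
  case: v uv => [z|] uv; last first.
    by rewrite subr0; apply: eq_bigl => y; rewrite andbT.
  apply: sum_predB => y; case: u uv => [x|] /=; rewrite ?andbT.
  - by move=> /(_ _ _ erefl erefl); lia.
  - by move=> _; lia.
  - by move=> _; lia.
  - by move=> _; lia.
case: u uv => [x|] uv; last by rewrite subr0.
apply: sum_predB => y; case: v uv => [z|] /=; rewrite ?andbT.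
- by move=> /(_ _ _ erefl erefl); lia.
- by move=> _; lia.
- by move=> _; lia.
- by move=> _; lia.
Qed.

End LocalConditions.

(* The coercion from boxes of a shape to boxes of the plane occurs in two
   convertible forms, which must agree before the arithmetic procedure. *)
Ltac slia := simpl in *; lia.

(** * Prolongations of a single strip *)

Section StripSums.

Variables (K : comNzRingType) (m : nat) (d : int -> direction).
Variable f : int -> 'I_m -> K.

(** The inequality between a box of content c and the preceding box of its
    strip; None as preceding letter stands for a strip about to start. *)
Definition step_ok (c : int) (x : option 'I_m) (y : 'I_m) : bool :=
  if d c is FromLeft then le_opt x y else gt_opt x y.

Fixpoint walk_sum (k : nat) (c : int) (x : option 'I_m) : K :=
  if k is k'.+1
  then \sum_(y | step_ok (c + 1) x y) f (c + 1) y * walk_sum k' (c + 1) (Some y)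
  else 1.

(** With c = q the strip is complete and the value is 1, with c > q it is 0:
    these are the conventions for an empty and for an undefined strip. *)
Definition strip_sum (c : int) (x : option 'I_m) (q : int) : K :=
  if c <= q then walk_sum `|q - c| c x else 0.

(** One recursion valid for all c and q: the strip either stops at c, which
    needs q = c, or acquires a box of content c + 1. *)
Lemma strip_sumE c x q :
  strip_sum c x q = (q == c)%:R +
    \sum_(y | step_ok (c + 1) x y) f (c + 1) y * strip_sum (c + 1) (Some y) q.
Proof.
rewrite /strip_sum; case: (ltgtP c q) => [cq|qc|<-].
- have -> : `|q - c|%N = `|(q - (c + 1))%R|.+1 by lia.
  have -> : (c + 1 <= q) = true by lia.
  by rewrite add0r.
- have -> : (c + 1 <= q) = false by lia.
  by rewrite big1 ?addr0 // => y _; rewrite mulr0.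
- have -> : (c + 1 <= c) = false by lia.
  by rewrite subrr big1 ?addr0 // => y _; rewrite mulr0.
Qed.

Lemma strip_sum_gt c x q : q < c -> strip_sum c x q = 0.
Proof. by rewrite /strip_sum ltNge; case: leP. Qed.

End StripSums.

(** * Geometry of a decomposition into strips *)

Section Decomposition.

Variables (E : {fset box}) (n : nat) (theta : 'I_n -> {fset box}).
Variables (start_ end_ : 'I_n -> box) (d : int -> direction).
Implicit Types (b : box) (c : int) (i j k : 'I_n).
Hypothesis E_convex : order_convex E.
Hypothesis theta_disj : forall j k b, b \in theta j -> b \in theta k -> j = k.
Hypothesis theta_cover : forall b, b \in E <-> exists j, b \in theta j.
Hypothesis theta_compat : compatible E theta d.
Hypothesis startP : forall j, is_start (theta j) (start_ j).
Hypothesis endP : forall j, is_end (theta j) (end_ j).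

(** Of the two neighbours of b that have content one less, [prev b] is the one
    through which strips enter b, and [side b] is the other one. *)
Definition prev (b : box) : box :=
  if d (content b) is FromLeft then left_of b else below b.
Definition side (b : box) : box :=
  if d (content b) is FromLeft then below b else left_of b.

Definition first_content j := content (start_ j).
Definition last_content j := content (end_ j).
Local Notation p := first_content.
Local Notation q := last_content.

(** The box of content c of the j-th strip, found by going backwards from the
    ending box.  Just before the first content this reaches the box preceding
    the start, which lies outside the diagram. *)
Definition walk (j : 'I_n) (c : int) : box := iter `|q j - c| prev (end_ j).

Lemma content_prev b : content (prev b) = content b - 1.
Proof. by rewrite /prev /content; case: (d _) => /=; lia. Qed.

Lemma content_side b : content (side b) = content b - 1.
Proof. by rewrite /side /content; case: (d _) => /=; lia. Qed.

Lemma prev_inj b b' : content b = content b' -> prev b = prev b' -> b = b'.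
Proof.
rewrite /prev => ->; case: (d _); case: b b' => [i j] [i' j'];
by rewrite /left_of /below /= => -[e1 e2]; congr (_, _); lia.
Qed.

Lemma theta_sub j b : b \in theta j -> b \in E.
Proof. by move=> bj; apply/theta_cover; exists j. Qed.

Lemma start_in j : start_ j \in theta j. Proof. by have [] := startP j. Qed.
Lemma end_in j : end_ j \in theta j. Proof. by have [] := endP j. Qed.

Lemma content_theta j b : b \in theta j -> p j <= content b <= q j.
Proof.
move=> bj; have [_ /(_ _ bj)] := startP j; have [_ /(_ _ bj)] := endP j.
by rewrite /first_content /last_content /content; lia.
Qed.

Lemma start_unique j b : b \in theta j -> content b = p j -> b = start_ j.
Proof.
move=> bj; have [_ /(_ _ bj)] := startP j; rewrite /first_content /content.
case: b (start_ j) {bj} => [i k] [i' k'] /= [le1 le2] eqc.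
by congr (_, _); lia.
Qed.

Lemma prev_in j b : b \in theta j -> p j < content b -> prev b \in theta j.
Proof.
move=> bj pb; have [/(_ _ _ bj) comp _] := theta_compat.
have /comp : ~ is_start (theta j) b.
  case=> _ /(_ _ (start_in j)); move: pb; rewrite /first_content /content.
  by lia.
by rewrite /prev; case: (d _).
Qed.

Lemma prev_start j : prev (start_ j) \notin E.
Proof.
have [_ /(_ _ _ (startP j))] := theta_compat.
by rewrite /prev; case: (d _) => /andP[].
Qed.

(** If b lay in the diagram it would belong to some strip.  As a starting box it
    would be on the perimeter, but [prev b] is in the diagram; otherwise its
    strip contains [prev b], which is already the last box of strip j. *)
Lemma prev_end b j : content b = q j + 1 -> prev b = end_ j -> b \notin E.
Proof.
move=> cb pb; apply/negP => /theta_cover[k bk].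
have [pk|pk] := boolP (p k < content b).
  have pbk := prev_in bk pk; rewrite pb in pbk.
  have jk := theta_disj (end_in j) pbk; rewrite -jk in bk.
  by have := content_theta bk; lia.
have bs : b = start_ k.
  by apply: start_unique => //; have := content_theta bk; lia.
by have := prev_start k; rewrite -bs pb (theta_sub (end_in j)).
Qed.

Lemma content_walk j c : c <= q j -> content (walk j c) = c.
Proof.
have iterE h b : content (iter h prev b) = content b - h%:Z.
  by elim: h => [|h IHh] /=; rewrite ?content_prev ?IHh; lia.
by rewrite /walk iterE /last_content; lia.
Qed.

Lemma prev_walk j c : c < q j -> prev (walk j (c + 1)) = walk j c.
Proof.
by move=> cq; rewrite /walk; have -> : `|q j - c|%N = `|(q j - (c + 1))%R|.+1 by lia.
Qed.

Lemma walk_in j c : p j <= c -> c <= q j -> walk j c \in theta j.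
Proof.
move=> pc cq; have [h hE] : {h : nat | q j = c + h%:Z}.
  by exists `|q j - c|%N; lia.
elim: h c pc cq hE => [|h IHh] c pc cq hE.
  have -> : walk j c = end_ j; last exact: end_in.
  by rewrite /walk (_ : q j - c = 0) //; lia.
have cq1 : c < q j by lia.
by rewrite -prev_walk // prev_in ?content_walk ?IHh //; lia.
Qed.

Lemma theta_unique j b b' :
  b \in theta j -> b' \in theta j -> content b = content b' -> b = b'.
Proof.
have [h] : {h : nat | `|content b - p j|%N = h} by exists `|content b - p j|%N.
elim: h b b' => [|h IHh] b b' hE bj b'j cbb'.
  have cb : content b = p j by lia.
  by rewrite (start_unique bj cb); apply/esym/start_unique => //; lia.
have := content_theta bj => /andP[pb _].
apply: (prev_inj cbb'); apply: IHh; rewrite ?content_prev ?prev_in //; lia.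
Qed.

Lemma walk_content j b : b \in theta j -> walk j (content b) = b.
Proof.
move=> bj; have /andP[pb bq] := content_theta bj.
by apply: (theta_unique (j := j)); rewrite ?walk_in ?content_walk.
Qed.

Lemma pq j : p j <= q j.
Proof. by have := content_theta (end_in j) => /andP[]. Qed.

Lemma walk_before_start j : walk j (p j - 1) \notin E.
Proof.
have pqj := pq j; rewrite -prev_walk; last by lia.
by rewrite subrK /first_content walk_content ?start_in ?prev_start.
Qed.

Definition next (b : box) : box :=
  if d (content b + 1) is FromLeft then right_of b else above b.

Lemma next_end j : next (end_ j) \notin E.
Proof.
have cN : content (next (end_ j)) = q j + 1.
  by rewrite /next /last_content /content; case: (d _) => /=; lia.
apply: (prev_end cN); rewrite /prev cN /next /last_content.
by case: (d _); case: (end_ j) => [r s]; rewrite /left_of /below /= ?addrK ?subrK.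
Qed.

(** When a strip ends at content c it is the extremal one on the diagonal c, on
    the side where no row is left to subtract.  Every box of content c + 1
    therefore has its second neighbour in the diagram, and the entry 1 of the
    ending strip cancels in all other rows. *)
Lemma side_in_of_end i b :
  b \in E -> content b = q i + 1 -> side b \in E.
Proof.
move=> bE cb; have := next_end i; have eE := theta_sub (end_in i).
have beq (b1 b2 : box) : b1.1 = b2.1 -> b1.2 = b2.2 -> b1 = b2.
  by case: b1 b2 => [? ?] [? ?] /= -> ->.
rewrite /side /next cb -/(q i); move: cb; rewrite /last_content /content.
case: (d _) => cb nE;
  have [lt|gt|eq] := ltgtP b.1 (end_ i).1.
- by apply: (E_convex bE eE) => /=; lia.
- by case/negP: nE; apply: (E_convex eE bE) => /=; lia.
- case/negP: nE; suff -> : right_of (end_ i) = b by [].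
  by apply: beq => /=; lia.
- have [lt'|eq'] : b.1 < (end_ i).1 - 1 \/ b.1 = (end_ i).1 - 1 by lia.
    by case/negP: nE; apply: (E_convex bE eE) => /=; lia.
  case/negP: nE; suff -> : above (end_ i) = b by [].
  by apply: beq => /=; lia.
- by apply: (E_convex eE bE) => /=; lia.
- by apply: (E_convex eE bE) => /=; lia.
Qed.

(** Of two ending boxes with the same content, convexity would put the box
    following one of them into the diagram. *)
Lemma last_content_inj : injective q.
Proof.
move=> i j qij; apply: (theta_disj (end_in i)).
suff eij : end_ i = end_ j by rewrite eij end_in.
have wlg k l : q k = q l -> ~ (end_ k).1 < (end_ l).1.
  move=> {qij} qij lt; have := next_end k; have := next_end l.
  have iE := theta_sub (end_in k); have jE := theta_sub (end_in l).
  move: qij; rewrite /next /last_content /content => qij.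
  rewrite -qij; case: (d _) => nj ni.
    by case/negP: ni; apply: (E_convex iE jE) => /=; lia.
  by case/negP: nj; apply: (E_convex iE jE) => /=; lia.
have := wlg _ _ qij; have := wlg _ _ (esym qij); move: qij.
rewrite /last_content /content.
by case: (end_ i) (end_ j) => [? ?] [? ?] /= *; congr (_, _); lia.
Qed.

Lemma strip_exists (b : E) : exists j, val b \in theta j.
Proof. exact/theta_cover/valP. Qed.

Definition strip_of (b : E) : 'I_n := xchoose (strip_exists b).

Lemma strip_ofP (b : E) : val b \in theta (strip_of b).
Proof. exact: xchooseP (strip_exists b). Qed.

Lemma strip_of_eq (b : E) j : val b \in theta j -> strip_of b = j.
Proof. by move=> bj; apply: theta_disj (strip_ofP b) bj. Qed.

(** * Sweeping the contents *)

Section Step.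

Variables (K : comNzRingType) (m : nat) (f : int -> 'I_m -> K).
Implicit Types (M : {ffun E -> 'I_m}).

(** The row of a strip starting at content c + 1 falls under the last case: its
    [walk] leaves the diagram at content c and the lookup yields None. *)
Definition front_mx c M : 'M[K]_n :=
  \matrix_(j, i) if q j < c then (i == j)%:R
    else if c + 1 < p j then strip_sum d f (p j - 1) None (q i)
    else strip_sum d f c (lookup M (walk j c)) (q i).

Lemma sum_local_row (M : {ffun E -> 'I_m}) b (F : 'I_m -> K) :
  (forall b' : E, content (val b') = content b - 1 -> local M (val b') (M b')) ->
  \sum_(y | local M b y) F y
    = \sum_(y | step_ok d (content b) (lookup M (prev b)) y) F y
      - (if lookup M (side b) is Some _
         then \sum_(y | step_ok d (content b) (lookup M (side b)) y) F y else 0).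
Proof.
move=> locM.
have [] := @sum_interlace m K F (lookup M (left_of b)) (lookup M (below b)).
  by move=> u v; apply: local_square.
by rewrite /step_ok /prev /side; case: (d _).
Qed.

(** The determinant at c is the sum over the admissible fillings of the diagonal
    c + 1 of the determinants at c + 1.  Three matrices intervene: A at c; B
    after subtracting from each row the row of the strip on the second
    neighbour of its new box; C, where the strips ending at c get unit rows. *)
Lemma front_step c (M0 : {ffun E -> 'I_m}) :
  (forall b : E, content (val b) = c -> local M0 (val b) (M0 b)) ->
  \det (front_mx c M0) =
    \sum_(M in family (fun b : E => if content (val b) == c + 1
                          then local M0 (val b) else pred1 (M0 b)))
      (\prod_(b : E | content (val b) == c + 1) f (c + 1) (M b))
        * \det (front_mx (c + 1) M).
Proof.
move=> locM0; set A := front_mx c M0.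
pose act j := p j <= c + 1 <= q j.
pose up j := if act j then omap strip_of (insub (side (walk j (c + 1)))) else None.
have act_in j : act j -> walk j (c + 1) \in theta j.
  by case/andP; apply: walk_in.
have act_content j : act j -> content (walk j (c + 1)) = c + 1.
  by case/andP => _; apply: content_walk.
have act_prev j : act j -> prev (walk j (c + 1)) = walk j c.
  by case/andP => _ ?; apply: prev_walk; lia.
have up_walk j k : up j = Some k -> act j /\ walk k c = side (walk j (c + 1)).
  rewrite /up; case: ifP => // actj; case: insubP => //= u _ uE [<-]; split=> //.
  have := walk_content (strip_ofP u).
  by rewrite /= uE content_side act_content // addrK.
(* The second neighbour lies one step further along the diagonal c, downwards
   or upwards according to the direction. *)
pose rk j := if d (c + 1) is FromLeft then (walk j c).1 else - (walk j c).1.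
have rk_up j k : up j = Some k -> rk j < rk k.
  case/up_walk => actj kE; rewrite /rk kE -act_prev // /side /prev act_content //.
  by case: (d _) => /=; lia.
pose B : 'M[K]_n := \matrix_(j, i) (A j i - (if up j is Some k then A k i else 0)).
have <- : \det B = \det A by apply: det_sub_rows rk_up _ => j i; rewrite mxE.
(* Row of an active strip after subtraction: a sum over exactly the letters that
   the tableau allows in its new box. *)
pose V y i := strip_sum d f (c + 1) (Some y) (q i).
have Bact j i : act j ->
    B j i = \sum_(y | local M0 (walk j (c + 1)) y) f (c + 1) y * V y i.
  move=> actj; set w := walk j (c + 1).
  have cw : content w = c + 1 by apply: act_content.
  have wE : w \in E by apply: theta_sub (act_in _ actj).
  have AE k : p k <= c + 1 -> c <= q k ->
      A k i = (q i == c)%:R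
        + \sum_(y | step_ok d (c + 1) (lookup M0 (walk k c)) y)
            f (c + 1) y * V y i.
    move=> pk qk; rewrite mxE.
    have -> : (q k < c) = false by lia.
    have -> : (c + 1 < p k) = false by lia.
    by rewrite strip_sumE.
  have /andP[pj qj] := actj; rewrite mxE AE; [|lia..].
  have locM0w : forall b : E, content (val b) = content w - 1 ->
      local M0 (val b) (M0 b) by rewrite cw addrK.
  rewrite sum_local_row // cw act_prev //.
  have [sE|sE] := boolP (side w \in E); last first.
    have -> : up j = None by rewrite /up actj insubN.
    rewrite (lookup_notin M0 sE) !subr0.
    case: (q i =P c) => [qi|_]; last by rewrite add0r.
    by case/negP: sE; apply: (side_in_of_end wE (i := i)); rewrite cw qi.
  have upE : up j = Some (strip_of [` sE]) by rewrite /up actj insubT.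
  have [_ kE] := up_walk _ _ upE; rewrite -/w in kE.
  have := content_theta (strip_ofP [` sE]).
  rewrite /= content_side cw addrK => /andP[pk qk].
  rewrite upE AE ?kE; [|lia..].
  by rewrite (lookup_in M0 sE) opprD addrACA subrr add0r.
(* In B the column of a strip ending at c is zero off the diagonal: after the
   subtraction, the other unfinished strips are already beyond content c. *)
pose C : 'M[K]_n := \matrix_(j, i) if q j == c then (i == j)%:R else B j i.
have Bcol i j : q i = c -> j != i -> B j i = 0.
  move=> qi ji; have [actj|nactj] := boolP (act j).
    by rewrite Bact // big1 // => y _; rewrite /V strip_sum_gt ?mulr0 // qi; lia.
  rewrite mxE /up (negbTE nactj) subr0 mxE eq_sym (negbTE ji).
  case: ltP => // qjc; case: ltP => [cpj|pjc].
    by rewrite strip_sum_gt // qi; lia.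
  have qij : q i = q j by move: nactj; rewrite /act; lia.
  by rewrite (last_content_inj qij) eqxx in ji.
have -> : \det B = \det C.
  apply: (det_unit_cols (D := fun i => q i == c)).
  - by move=> i j /eqP; apply: Bcol.
  - move=> i j /eqP qi ji; rewrite mxE Bcol // [i == j]eq_sym (negbTE ji).
    by case: ifP.
  - move=> i /eqP qi; rewrite [RHS]mxE [LHS]mxE qi !eqxx mxE.
    have := pq i => pqi.
    have -> : up i = None by rewrite /up /act qi; case: ifP => //; lia.
    have -> : (q i < c) = false by lia.
    have -> : (c + 1 < p i) = false by lia.
    by rewrite /strip_sum qi lexx subrr subr0.
  - by move=> j i /negbTE qj; rewrite [RHS]mxE qj.
apply: (@det_expand_rows _ _ _ _ C (fun b : E => content (val b) == c + 1)
  strip_of (fun b : E => local M0 (val b)) (fun _ => f (c + 1)) V M0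
  (front_mx (c + 1))).
- move=> b b' /eqP cb /eqP cb' bb'; apply: val_inj.
  apply: (theta_unique (j := strip_of b)); rewrite ?strip_ofP ?cb ?cb' //.
  by rewrite bb' strip_ofP.
- move=> b i /eqP cb; have bj := strip_ofP b; have := content_theta bj.
  rewrite cb => actj; rewrite mxE; have -> : (q (strip_of b) == c) = false by lia.
  by rewrite Bact // -cb walk_content.
- move=> M b i /eqP cb; have bj := strip_ofP b; have := content_theta bj.
  rewrite cb => actj; rewrite mxE.
  have -> : (q (strip_of b) < c + 1) = false by lia.
  have -> : (c + 1 + 1 < p (strip_of b)) = false by lia.
  by rewrite -{2}cb walk_content // lookup_val.
move=> M j i nj; have nactj : ~~ act j.
  apply/negP => actj; have wE := theta_sub (act_in _ actj).
  have := nj [` wE]; rewrite /= act_content // eqxx => /(_ isT).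
  by rewrite (strip_of_eq (b := [` wE]) (act_in _ actj)) eqxx.
have BA : B j i = A j i by rewrite mxE /up (negbTE nactj) subr0.
rewrite [RHS]mxE BA !mxE; have [qj|qj] := ltP (q j) (c + 1).
  by case: (q j =P c) => // qjc; have -> : q j < c by lia.
have pj : c + 1 < p j by move: nactj; rewrite /act; lia.
have -> : (q j == c) = false by lia.
have -> : (q j < c) = false by lia.
rewrite pj; case: ltP => // pjc.
have -> : c + 1 = p j - 1 by lia.
by rewrite lookup_notin // walk_before_start.
Qed.

Lemma int_trichotomy (x y : int) : x < y \/ y < x \/ x = y.
Proof. by lia. Qed.

(** Boxes not yet reached carry the default letter y0, which makes partial
    fillings a subset of the full ones. *)
Variable y0 : 'I_m.

Definition filled_upto c M : bool :=
  [forall b : E, if content (val b) <= c then local M (val b) (M b)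
                 else M b == y0].

Definition truncate c M : {ffun E -> 'I_m} :=
  [ffun b : E => if content (val b) <= c then M b else y0].

Lemma filled_upto_truncate c M : filled_upto (c + 1) M -> filled_upto c (truncate c M).
Proof.
move=> /forallP fillM; apply/forallP => b; have := fillM b.
rewrite ffunE; have [bc|//] := boolP (content (val b) <= c).
have -> : content (val b) <= c + 1 by slia.
rewrite (@eq_local _ _ _ (truncate c M)) // => b' cb'.
by rewrite ffunE cb' (le_trans _ bc) // gerBl.
Qed.

(** The inner sum of [front_step] ranges over the fillings extending M0 by one
    diagonal; the local conditions may be read off M0 or off the extension,
    since they only look at the preceding diagonal. *)
Lemma filled_uptoS c M0 M : filled_upto c M0 ->
  filled_upto (c + 1) M && (truncate c M == M0) =
  (M \in family (fun b : E => if content (val b) == c + 1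
                             then local M0 (val b) else pred1 (M0 b))).
Proof.
move=> /forallP fillM0.
have eq_loc (b : E) : (forall b' : E, content (val b') <= c -> M b' = M0 b') ->
    content (val b) <= c + 1 -> local M (val b) =1 local M0 (val b).
  by move=> MM0 bc y; apply: eq_local => b' cb'; apply: MM0; slia.
apply/andP/familyP => [[/forallP fillM /eqP truncM] b|famM].
  have MM0 (b' : E) : content (val b') <= c -> M b' = M0 b'.
    by move=> b'c; rewrite -truncM ffunE b'c.
  have := fillM b; have [bc|[bc|bc]] := int_trichotomy (content (val b)) (c + 1).
  - move=> _; have -> : (content (val b) == c + 1) = false by slia.
    by apply/eqP/MM0; slia.
  - have -> : (content (val b) <= c + 1) = false by slia.
    have -> : (content (val b) == c + 1) = false by slia.
    rewrite inE => /eqP ->; rewrite -truncM ffunE.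
    by have -> : (content (val b) <= c) = false by slia.
  - by rewrite bc lexx eqxx -topredE /= -(eq_loc b MM0) // bc.
have MM0 (b : E) : content (val b) != c + 1 -> M b = M0 b.
  by move=> /negbTE bc; have := famM b; rewrite bc inE => /eqP.
have MM0c (b : E) : content (val b) <= c -> M b = M0 b.
  by move=> bc; apply: MM0; slia.
split.
  apply/forallP => b; have := famM b; have := fillM0 b.
  have [bc|[bc|bc]] := int_trichotomy (content (val b)) (c + 1).
  - have b_le : content (val b) <= c by slia.
    have -> : content (val b) <= c + 1 by slia.
    by rewrite b_le (eq_loc b MM0c) ?MM0c //; slia.
  - have -> : (content (val b) <= c) = false by slia.
    have -> : (content (val b) <= c + 1) = false by slia.
    by move=> /eqP <- _; apply/eqP/MM0; slia.
  - by rewrite bc lexx eqxx (eq_loc b MM0c) // bc.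
apply/eqP/ffunP => b; rewrite ffunE.
have [bc|bc] := boolP (content (val b) <= c); first exact: MM0c.
by have := fillM0 b; rewrite (negbTE bc) => /eqP.
Qed.

Lemma front_sum c0 h :
  (forall b : E, c0 < content (val b)) ->
  \det (front_mx c0 [ffun=> y0]) =
    \sum_(M | filled_upto (c0 + h%:Z) M)
      (\prod_(b : E | content (val b) <= c0 + h%:Z) f (content (val b)) (M b))
        * \det (front_mx (c0 + h%:Z) M).
Proof.
move=> lt_c0; elim: h => [|h ->].
  rewrite addr0 (big_pred1 [ffun=> y0]) => [|M].
    by rewrite big_pred0 ?mul1r // => b; rewrite leNgt lt_c0.
  apply/forallP/eqP => [fillM|-> b].
    by apply/ffunP => b; have := fillM b; rewrite leNgt lt_c0 ffunE => /eqP.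
  by rewrite leNgt lt_c0 /= ffunE.
set c := c0 + h%:Z; have -> : c0 + h.+1%:Z = c + 1 by rewrite /c; slia.
rewrite [RHS](partition_big (truncate c) (filled_upto c)) /=; last first.
  exact: filled_upto_truncate.
apply: eq_bigr => M0 fillM0; rewrite front_step => [|b bc]; last first.
  by have /forallP/(_ b) := fillM0; rewrite bc lexx.
rewrite mulr_sumr; apply: eq_big => [M|M famM].
  by rewrite filled_uptoS.
rewrite mulrA; congr (_ * _).
rewrite [RHS](bigID (fun b : E => content (val b) <= c)) /=; congr (_ * _).
  apply: eq_big => [b|b bc]; first by slia.
  have /familyP/(_ b) := famM; have -> : (content (val b) == c + 1) = false by slia.
  by rewrite inE => /eqP ->.
by apply: eq_big => [b|b /eqP ->] //; slia.
Qed.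

(** The sweep from before all contents, where the matrix is the one of complete
    prolongations, to beyond them, where it is the identity. *)
Theorem strip_determinant :
  \sum_(M : {ffun E -> 'I_m} | [forall b : E, local M (val b) (M b)])
    \prod_(b : E) f (content (val b)) (M b) =
  \det (\matrix_(j, i) strip_sum d f (p j - 1) None (q i)).
Proof.
have [B leB] : exists B : nat, forall b, b \in E -> (`|content b| <= B)%N.
  exists (\max_(b : E) `|content (val b)|%N) => b bE.
  exact: (@leq_bigmax _ (fun b : E => `|content (val b)|%N) [` bE]).
have leBp j : (`|p j| <= B)%N by apply/leB/theta_sub/start_in.
have leBq j : (`|q j| <= B)%N by apply/leB/theta_sub/end_in.
pose c0 : int := - B%:Z - 2.
have -> : \matrix_(j, i) strip_sum d f (p j - 1) None (q i)
    = front_mx c0 [ffun=> y0].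
  apply/matrixP => j i; rewrite !mxE /c0; have := leBp j; have := leBq j => *.
  have -> : (q j < - B%:Z - 2) = false by slia.
  by have -> : - B%:Z - 2 + 1 < p j by slia.
(* The contents lie in [-B, B]; c0 = -B - 2 leaves every start strictly after
   c0 + 1, and c0 + (2B + 3) = B + 1 is beyond every end. *)
rewrite (@front_sum c0 (B + B + 3)) => [|b]; last first.
  by have := leB _ (valP b); rewrite /c0; slia.
apply/esym/eq_big => [M|M _].
  apply: eq_forallb => b; have := leB _ (valP b) => cb.
  by have -> : content (val b) <= c0 + (B + B + 3)%N by rewrite /c0; slia.
rewrite (_ : front_mx _ M = 1%:M) ?det1 ?mulr1.
  apply: eq_bigl => b; have := leB _ (valP b) => cb.
  by rewrite /c0; slia.
apply/matrixP => j i; rewrite !mxE [i == j]eq_sym; have := leBq j => qj.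
by have -> : q j < c0 + (B + B + 3)%N by rewrite /c0; slia.
Qed.

End Step.

End Decomposition.

(** * The strips R[p,q] *)

Section Ribbon.

Variables (d : int -> direction) (p q : int).
Implicit Types (b : box) (k l h : nat).

Lemma content_ribbon_box k : content (ribbon_box d p k) = p + k%:Z.
Proof.
elim: k => [|k]; first by rewrite /content /=; lia.
by rewrite /content /=; case: (d _) => /=; lia.
Qed.

Lemma ribbon_box_mono k l : (k <= l)%N ->
  (ribbon_box d p l).1 <= (ribbon_box d p k).1 /\
  (ribbon_box d p k).2 <= (ribbon_box d p l).2.
Proof.
move=> /subnK <-; elim: (l - k)%N => [|h]; first by rewrite add0n.
by rewrite addSn /=; case: (d _) => /=; lia.
Qed.

Lemma ribbonP b :
  reflect (exists2 k, (k <= `|q - p|)%N & b = ribbon_box d p k) (b \in ribbon d p q).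
Proof.
have kE k : (k <= `|q - p|)%N = (k \in iota 0 `|q - p|.+1).
  by rewrite mem_iota add0n ltnS.
apply: (iffP idP) => [/imfsetP[k kI ->]|[k + ->]].
  by exists k => //; rewrite kE.
by rewrite kE => kI; apply/imfsetP; exists k.
Qed.

(** Two comparable boxes of a strip lie in one row or one column, so a box
    between them is determined by its content. *)
Lemma ribbon_convex : order_convex (ribbon d p q).
Proof.
move=> b1 b2 b /ribbonP[k kq ->] /ribbonP[l lq ->] rows cols.
apply/ribbonP; have := content_ribbon_box k; have := content_ribbon_box l.
pose h := `|content b - p|%N; have := content_ribbon_box h.
have [kl|lk] := leqP k l.
  have := ribbon_box_mono kl => -[r c] ch cl ck.
  have kh : (k <= h)%N by move: ch cl ck; rewrite /h /content; lia.
  have hl : (h <= l)%N by move: ch cl ck; rewrite /h /content; lia.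
  exists h; first exact: leq_trans lq.
  have := ribbon_box_mono kh; have := ribbon_box_mono hl.
  move: ch cl ck rows cols r c; rewrite /h /content.
  case: b (ribbon_box d p _) @h kh hl => [i j] [i' j'] /= *.
  by congr (_, _); lia.
have := ribbon_box_mono (ltnW lk) => -[r c] ch cl ck.
have hk : (h <= k)%N by move: ch cl ck; rewrite /h /content; lia.
have lh : (l <= h)%N by move: ch cl ck; rewrite /h /content; lia.
exists h; first exact: leq_trans kq.
have := ribbon_box_mono hk; have := ribbon_box_mono lh.
move: ch cl ck rows cols r c; rewrite /h /content.
case: b (ribbon_box d p _) @h hk lh => [i j] [i' j'] /= *.
by congr (_, _); lia.
Qed.

Lemma ribbon_start : is_start (ribbon d p q) (ribbon_box d p 0).
Proof.
split=> [|b /ribbonP[k _ ->]]; first by apply/ribbonP; exists 0%N.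
exact: ribbon_box_mono.
Qed.

Lemma ribbon_end : is_end (ribbon d p q) (ribbon_box d p `|q - p|).
Proof.
split=> [|b /ribbonP[k kq ->]]; first by apply/ribbonP; exists `|q - p|%N.
exact: ribbon_box_mono.
Qed.

Lemma ribbon_compatible :
  compatible (ribbon d p q) (fun _ : 'I_1 => ribbon d p q) d.
Proof.
split=> [_ _ /ribbonP[[|k] kq ->] nstart|_ b [bR b_start]].
- by case: nstart; apply: ribbon_start.
- rewrite content_ribbon_box /=.
  have kR : ribbon_box d p k \in ribbon d p q by apply/ribbonP; exists k => //; lia.
  case: (d _); rewrite /approached_from /left_of /below /= ?addrK ?subrK;
  by rewrite -surjective_pairing.
- case: (d _); rewrite /= /on_left /on_bottom bR /=; apply/negP => /b_start.
    by move=> [_] /=; lia.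
  by move=> [] /=; lia.
Qed.

(** A strip decomposes into itself, and the determinant has size 1. *)
Lemma ribbon_sum (K : comNzRingType) m (f : int -> 'I_m -> K) (y0 : 'I_m) :
  p <= q ->
  \sum_(M : {ffun ribbon d p q -> 'I_m} |
         [forall b : ribbon d p q, local M (val b) (M b)])
    \prod_(b : ribbon d p q) f (content (val b)) (M b) =
  strip_sum d f (p - 1) None q.
Proof.
move=> le_pq; rewrite (strip_determinant (theta := fun _ : 'I_1 => ribbon d p q)
  (start_ := fun _ => ribbon_box d p 0)
  (end_ := fun _ => ribbon_box d p `|q - p|) ribbon_convex _ _
  ribbon_compatible) //.
- rewrite det_mx11 mxE /first_content /last_content !content_ribbon_box.
  by rewrite addr0; congr strip_sum; lia.
- by move=> j k b _ _; rewrite !ord1.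
- by move=> b; split=> [bR|[]//]; exists ord0.
- by move=> _; apply: ribbon_start.
- by move=> _; apply: ribbon_end.
Qed.

End Ribbon.

(** * Skew diagrams and symplectic weights *)

Lemma diagramP (la : seq nat) (b : box) :
  reflect (exists i j : nat, b = (i.+1%:Z, j.+1%:Z) /\ (j < nth 0%N la i)%N)
          (b \in diagram la).
Proof.
apply: (iffP idP) => [/imfset2P[i iI [j jI ->]]|[i [j [-> jl]]]].
  have {iI} : i \in iota 1 (size la) by [].
  rewrite mem_iota add1n ltnS => /andP[i0 _].
  have {jI} : j \in iota 1 (nth 0%N la i.-1) by [].
  rewrite mem_iota add1n ltnS => /andP[j0 jl].
  by exists i.-1, j.-1; rewrite !prednK.
have i_la : (i < size la)%N by case: ltnP => // lai; rewrite nth_default in jl.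
have iI : i.+1 \in iota 1 (size la) by rewrite mem_iota add1n ltnS.
have jI : j.+1 \in iota 1 (nth 0%N la i.+1.-1) by rewrite mem_iota add1n ltnS.
by apply/imfset2P; exists i.+1 => //; exists j.+1.
Qed.

Lemma diagram_down (la : seq nat) (b b' : box) :
  is_part la -> b' \in diagram la -> 1 <= b.1 <= b'.1 -> 1 <= b.2 <= b'.2 ->
  b \in diagram la.
Proof.
case/andP=> la_sorted _ /diagramP[i [j [-> jl]]] /= rows cols.
apply/diagramP; exists `|b.1|.-1, `|b.2|.-1; split.
  by move: rows cols; case: b => r s /= *; congr (_, _); lia.
have ri : (`|b.1|.-1 <= i)%N by lia.
have sj : (`|b.2|.-1 <= j)%N by lia.
apply: leq_ltn_trans sj (leq_trans jl _).
have geq_trans : transitive geq.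
  by move=> x y z; rewrite /geq /= => /[swap]; apply: leq_trans.
have [i_la|la_i] := ltnP i (size la); last by rewrite nth_default.
by apply: (sorted_leq_nth geq_trans leqnn 0%N la_sorted); rewrite ?inE; lia.
Qed.

Lemma skew_diagram_convex (la mu : seq nat) :
  is_part la -> is_part mu -> order_convex (skew_diagram la mu).
Proof.
move=> la_part mu_part b1 b2 b; rewrite !in_fsetD.
move=> /andP[b1mu b1la] /andP[_ b2la] rows cols.
have [r1 s1] : 1 <= b1.1 /\ 1 <= b1.2.
  by have /diagramP[i [j [-> _]]] := b1la.
apply/andP; split; last by apply: (diagram_down la_part b2la); lia.
by apply: contra b1mu => bmu; apply: (diagram_down mu_part bmu); lia.
Qed.

Section Symplectic.

Variables (R : realType) (N : nat) (a : int -> R[i]).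

Definition sp_weight (c : int) (y : letter N) : R[i] :=
  if (c <= 0) ==> (`|c|.*2 <= y)%N then cpow (letter_abs R y) (a c) else 0.

(** A violated content condition gives a factor 0, so the sum may run over all
    tableaux. *)
Lemma spS_local (E : {fset box}) (s : E -> R[i]) :
  order_convex E -> (forall b : E, s b = a (content (val b))) ->
  spS N s = \sum_(M : {ffun E -> letter N} | [forall b : E, local M (val b) (M b)])
              \prod_(b : E) sp_weight (content (val b)) (M b).
Proof.
move=> convE sE; rewrite /spS big_mkcond [RHS]big_mkcond /=.
apply: eq_bigr => M _; rewrite /is_sptab andbA -local_tableau //.
case: [forall b, local _ _ _] => //=.
case: ifPn => [/forallP flag|].
  by apply: eq_bigr => b _; rewrite sE /sp_weight flag.
rewrite negb_forall => /existsP[b /negbTE flag].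
by rewrite (bigD1 b) //= /sp_weight flag mul0r.
Qed.

(** The cases p <= q, p = q + 1 and p > q + 1 of the operation # become the
    cases of [strip_sum] started one step before p. *)
Lemma sharp_entry_strip_sum (d : int -> direction) (b e : box) :
  (0 < N)%N ->
  sharp_entry N a (sharp d b e)
    = strip_sum d sp_weight (content b - 1) None (content e).
Proof.
move=> N0; have y0 : letter N by exists 0%N; rewrite double_gt0.
rewrite /sharp; have [le_be|lt_eb] := boolP (content b <= content e).
  rewrite /=; case: eqP => [R0|_].
    have := ribbon_start d (content b) (content e).
    by rewrite R0 => -[]; rewrite inE.
  rewrite spS_local //; first exact: ribbon_sum.
  exact: ribbon_convex.
case: eqP => [->|ne] /=.
  by rewrite ?eqxx addrK /strip_sum lexx subrr.
by rewrite strip_sum_gt //; lia.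
Qed.

End Symplectic.

Theorem theorem10p9 (R : realType) (la mu : seq nat) (N : nat)
    (a : int -> R[i]) (s : skew_diagram la mu -> R[i])
    (n : nat) (theta : 'I_n -> {fset box}) (start_ end_ : 'I_n -> box)
    (d : int -> direction) :
  is_part la -> is_part mu -> diagram mu `<=` diagram la ->
  (0 < N)%N ->
  (forall b : skew_diagram la mu, s b = a (content (val b))) ->
  outside_decomposition (skew_diagram la mu) theta ->
  compatible (skew_diagram la mu) theta d ->
  (forall i, is_start (theta i) (start_ i)) ->
  (forall i, is_end (theta i) (end_ i)) ->
  spS N s
    = \det (\matrix_(i < n, j < n) sharp_entry N a (sharp d (start_ j) (end_ i))).
Proof.
move=> la_part mu_part _ N0 sE [_ disj cover _ _] compat startP endP.
have y0 : letter N by exists 0%N; rewrite double_gt0.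
have convE := skew_diagram_convex la_part mu_part.
rewrite (spS_local _ convE sE) (strip_determinant convE _ _ compat startP endP) //.
- rewrite -det_tr; congr (\det _); apply/matrixP => i j; rewrite !mxE.
  by rewrite sharp_entry_strip_sum.
- move=> j k b bj bk; apply/eqP; apply: contraTT bk => jk.
  exact: (fdisjointP (disj _ _ jk)).
move=> b; rewrite cover; split=> [/bigfcupP[j _ bj]|[j bj]]; first by exists j.
by apply/bigfcupP; exists j => //; rewrite mem_index_enum.
Qed.
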